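(* There exists a $(1-\frac{1}{e})$-competitive online algorithm for online concave diminishing-returns allocation (OCDRA): for every instance of OCDRA with objective $f$, the allocation $\mathbf{x}$ produced by the algorithm is feasible and satisfies $f(\mathbf{x}) \geq (1-\frac{1}{e}) f(\mathbf{x}^* )$ for every feasible allocation $\mathbf{x}^*$ (i.e., every $\mathbf{x}^* \in \mathbb{R}_{\geq 0}^A$ with $\sum_{a\in A_j} x^*_a \le 1$ for all $j$).
   Context: A function $f:\mathbb{R}_{\geq 0}^m\to\mathbb{R}_{\geq 0}$ is upward-differentiable if for every $\mathbf{x}\in\mathbb{R}_{\geq 0}^m$ there is an upward-gradient $\nabla f(\mathbf{x})\in\mathbb{R}^m$ with $\lim_{\epsilon\to 0^+}(f(\mathbf{x}+\epsilon\mathbf{y})-f(\mathbf{x}))/\epsilon=\langle\nabla f(\mathbf{x}),\mathbf{y}\rangle$ for every $\mathbf{y}\in\mathbb{R}_{\geq 0}^m$; all functions considered are assumed upward-differentiable. An instance of OCDRA is as follows. A set $[n]$ of divisible items arrives online one by one. When item $j$ arrives it reveals a finite set $A_j$ of allocation options; the sets $A_j$ are pairwise disjoint and $A=\bigcup_j A_j$. The algorithm must immediately and irrevocably choose a vector $(x_a)_{a\in A_j}$ with $x_a\ge 0$ and $\sum_{a\in A_j}x_a\le 1$. The objective is to maximize $f(\mathbf{x})$, where $f:\mathbb{R}_{\geq 0}^A\to\mathbb{R}_{\geq 0}$ satisfies: $f(0)=0$; $f$ is concave and monotone increasing; $f$ is upward-differentiable and $\nabla f$ is monotone decreasing coordinate-wise.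 Upon the $j$th arrival the algorithm only knows $f$ restricted to $A_1\cup\dots\cup A_j$, i.e., the function $\mathbf{y}\mapsto f(\mathbf{y},\mathbf{0}_{A\setminus S})$ on $\mathbb{R}_{\geq 0}^S$ for $S=A_1\cup\dots\cup A_j$ (all other coordinates zeroed out). *)

(* Defs.v *)
From HB Require Import structures.
From mathcomp Require Import all_boot all_order all_algebra.
From mathcomp Require Import finmap.
From mathcomp Require Import all_classical all_reals all_analysis.

Set Implicit Arguments.
Unset Strict Implicit.
Unset Printing Implicit Defensive.

Import Order.TTheory GRing.Theory Num.Theory.
Import numFieldNormedType.Exports.

Local Open Scope classical_set_scope.
Local Open Scope ring_scope.

Section OCDRA.
Variables (R : realType) (T : choiceType).

(* Options carry labels in an arbitrary type T. A vector indexed by a finite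
   set S of options is a function on T that vanishes outside S; in particular
   extending a vector by zero to a larger set of options is the identity. *)
Definition vec := T -> R^o.

(* R_{>=0}^S *)
Definition orthant (S : {fset T}) : set vec :=
  [set x | (forall a, 0 <= x a) /\ (forall a, a \notin S -> x a = 0)].

Definition all_options (A : seq {fset T}) : {fset T} := (\bigcup_(B <- A) B)%fset.

Definition lev (x y : vec) : Prop := forall a, x a <= y a.

(* Only the coordinates of g in S are meaningful; they are determined by f, S
   and x. *)
Definition upward_gradient (S : {fset T}) (f : vec -> R^o) (x g : vec) : Prop :=
  forall y, orthant S y ->
    (f (x + eps *: y) - f x) / eps @[eps --> 0^'+] --> \sum_(a <- S) g a * y a.

Definition upward_differentiable (S : {fset T}) (f : vec -> R^o) : Prop :=
  forall x, orthant S x -> exists g, upward_gradient S f x g.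

Definition gradient_decreasing (S : {fset T}) (f : vec -> R^o) : Prop :=
  forall x x' g g' : vec, orthant S x -> orthant S x' -> lev x x' ->
    upward_gradient S f x g -> upward_gradient S f x' g' ->
    forall a, a \in S -> g' a <= g a.

(* The items arrive in the order of the list A, whose j-th entry is A_j. The
   values of f outside of the orthant are irrelevant. *)
Record OCDRA_instance (A : seq {fset T}) (f : vec -> R^o) : Prop := {
  options_disjoint : pairwise (fun B C => [disjoint B & C]%fset) A ;
  objective_ge0 : forall x, orthant (all_options A) x -> 0 <= f x ;
  objective0 : f 0 = 0 ;
  objective_concave : convex_function (orthant (all_options A)) (\- f) ;
  objective_increasing : forall x y, orthant (all_options A) x ->
    orthant (all_options A) y -> lev x y -> f x <= f y ;
  objective_updiff : upward_differentiable (all_options A) f ;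
  objective_grad_decreasing : gradient_decreasing (all_options A) f }.

Definition feasible (A : seq {fset T}) (x : vec) : Prop :=
  orthant (all_options A) x /\
  forall B, B \in A -> \sum_(a <- B) x a <= 1.

(* The restriction of f to R_{>=0}^S. The value 0 is used outside of the
   orthant so that nothing else about f is disclosed. *)
Definition reveal (S : {fset T}) (f : vec -> R^o) : vec -> R^o :=
  patch (fun=> 0) (orthant S) f.

(* From the nonempty list of the option sets that have arrived so far and the
   objective revealed so far, the algorithm produces the allocation of the last
   item of the list. Past decisions need not be an input: they are
   functions of past information, which is contained in the current one. *)
Definition online_algorithm := seq {fset T} -> (vec -> R^o) -> vec.

Definition decision (alg : online_algorithm) (A : seq {fset T})
    (f : vec -> R^o) (j : nat) : vec :=
  let arrived := take j.+1 A in alg arrived (reveal (all_options arrived) f).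

(* On A_j the allocation is the j-th decision; find is the index of the item
   that the option a belongs to. *)
Definition allocation (alg : online_algorithm) (A : seq {fset T})
    (f : vec -> R^o) : vec :=
  fun a => if a \in all_options A
           then decision alg A f (find (fun B : {fset T} => a \in B) A) a
           else 0.

Definition competitive (c : R) (alg : online_algorithm) : Prop :=
  forall A f, OCDRA_instance A f ->
    feasible A (allocation alg A f) /\
    forall x, feasible A x -> c * f x <= f (allocation alg A f).

End OCDRA.

(* Main.v *)
Require Import Defs.
From mathcomp Require Import all_boot all_order all_algebra.
From mathcomp Require Import finmap ring lra.
From mathcomp Require Import all_classical all_reals all_analysis.

(* Fix N, put q = expR (1/N) and let the potential of x be the Riemann sum
   G x = sum_(k = 1..N) q^k k f (N/k x), a discretization of the integral of
   e^s s f (x/s) over [0, 1] (up to a constant factor). On each arrival take an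
   allocation of the item that maximizes G up to an additive 1. Moving by 1/N
   towards a competitor y then gains little: G (x + y/N) <= (1 + 1/N) G x + n,
   with n the number of items. On the other hand, by concavity,
   G (x + y/N) >= q (G x - e N f x) + f y (q + ... + q^N). As 1 + 1/N <= q, the
   potential cancels out and (1 - 1/e) f y <= q f x + n / (e N). The exact ratio
   is reached by letting N tend to infinity along an ultrafilter in every
   coordinate of every decision, f being Lipschitz on the orthant. *)

Set Implicit Arguments.
Unset Strict Implicit.
Unset Printing Implicit Defensive.

Import Order.TTheory GRing.Theory Num.Theory.
Import numFieldNormedType.Exports.

Local Open Scope classical_set_scope.
Local Open Scope ring_scope.

(** * The orthant and objectives with diminishing increments *)

Section Orthant.
Context {R : realType} {T : choiceType}.
Implicit Types (S : {fset T}) (x y z : vec R T).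

Lemma orthant0 S : orthant S (0 : vec R T).
Proof. by []. Qed.

Lemma orthantD S x y : orthant S x -> orthant S y -> orthant S (x + y).
Proof.
move=> [x0 xS] [y0 yS]; split=> a /=; first by rewrite addr_ge0.
by move=> aS; change (x a + y a = 0); rewrite xS// yS// addr0.
Qed.

Lemma orthantZ S (c : R) x : 0 <= c -> orthant S x -> orthant S (c *: x).
Proof.
move=> c0 [x0 xS]; split=> a /=; first by rewrite mulr_ge0.
by move=> aS; change (c * x a = 0); rewrite xS// mulr0.
Qed.

Lemma orthant_sub S S' x : (S `<=` S')%fset -> orthant S x -> orthant S' x.
Proof.
move=> /fsubsetP SS' [x0 xS]; split=> // a aS'; apply: xS.
by apply: contra aS'; exact: SS'.
Qed.

Lemma vecP x y : (forall a, x a = y a) -> x = y.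
Proof. exact: funext. Qed.

Lemma lev_addr x y : (forall a, 0 <= y a) -> lev x (x + y).
Proof. by move=> y0 a /=; rewrite lerDl. Qed.

(* Diminishing returns stated with increments rather than gradients, so that
   the property passes to sums and rescalings of objectives. *)
Record dr_objective (S : {fset T}) (f : vec R T -> R) : Prop := {
  dr0 : f 0 = 0 ;
  dr_increasing : forall x y, orthant S x -> orthant S y -> lev x y ->
    f x <= f y ;
  dr_concave : forall (t : R) x y, 0 <= t <= 1 -> orthant S x -> orthant S y ->
    t * f x + (1 - t) * f y <= f (t *: x + (1 - t) *: y) ;
  dr_increment : forall x y z, orthant S x -> orthant S y -> orthant S z ->
    lev x y -> f (y + z) - f y <= f (x + z) - f x }.

Lemma dr_objective_ge0 S f x : dr_objective S f -> orthant S x -> 0 <= f x.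
Proof.
move=> fdr xS; rewrite -(dr0 fdr); apply: (dr_increasing fdr) => //.
by move=> a; case: xS => x0 _; exact: x0.
Qed.

Lemma dr_objectiveZ S f (c d : R) : 0 <= c -> 0 <= d -> dr_objective S f ->
  dr_objective S (fun x => c * f (d *: x)).
Proof.
move=> c0 d0 fdr; split.
- by rewrite scaler0 (dr0 fdr) mulr0.
- move=> x y xS yS xy; rewrite ler_wpM2l//.
  by apply: (dr_increasing fdr); [exact: orthantZ..|move=> a /=; rewrite ler_wpM2l].
- move=> t x y t01 xS yS.
  have := dr_concave fdr t01 (orthantZ d0 xS) (orthantZ d0 yS).
  rewrite scalerDr !scalerA (mulrC d t) (mulrC d (1 - t)).
  by move=> /(ler_wpM2l c0); rewrite mulrDr !mulrA (mulrC t c) (mulrC (1 - t) c).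
- move=> x y z xS yS zS xy; rewrite -!mulrBr ler_wpM2l// !scalerDr.
  apply: (dr_increment fdr); [exact: orthantZ..|].
  by move=> a /=; rewrite ler_wpM2l.
Qed.

Lemma dr_objective_sum S n (F : nat -> vec R T -> R) :
  (forall k, dr_objective S (F k)) ->
  dr_objective S (fun x => \sum_(k < n) F k x).
Proof.
move=> Fdr; split.
- by rewrite big1// => k _; rewrite (dr0 (Fdr k)).
- by move=> x y xS yS xy; apply: ler_sum => k _; exact: (dr_increasing (Fdr k)).
- move=> t x y t01 xS yS; rewrite !mulr_sumr -big_split/=.
  by apply: ler_sum => k _; exact: (dr_concave (Fdr k)).
- move=> x y z xS yS zS xy; rewrite -!sumrB.
  by apply: ler_sum => k _; exact: (dr_increment (Fdr k)).
Qed.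

End Orthant.

(** * Concavity: increments against upward gradients *)

Section Gradient.
Context {R : realType} {T : choiceType}.
Variables (S : {fset T}) (f : vec R T -> R).
Hypothesis fconc : forall (t : R) (x y : vec R T), 0 <= t <= 1 ->
  orthant S x -> orthant S y ->
  t * f x + (1 - t) * f y <= f (t *: x + (1 - t) *: y).

(** For 0 < e < 1 the point x + e z is a convex combination of x + z and x, so the difference
    quotient at e is at least the full increment; this survives the limit e -> 0. *)
Lemma increment_le_gradient (x z g : vec R T) :
  orthant S x -> orthant S z -> upward_gradient S f x g ->
  f (x + z) - f x <= \sum_(a <- S) g a * z a.
Proof.
move=> xS zS /(_ z zS) /cvgr_to_ge; apply.
near=> e.
have e0 : 0 < e by near: e; exact: nbhs_right_gt.
have e1 : e < 1 by near: e; exact: nbhs_right_lt.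
rewrite ler_pdivlMr//.
have -> : x + e *: z = e *: (x + z) + (1 - e) *: x.
  apply: vecP => a.
  by change (x a + e * z a = e * (x a + z a) + (1 - e) * x a :> R); ring.
have /fconc /(_ (orthantD xS zS) xS) : 0 <= e <= 1 by rewrite !ltW.
set a := f _; set b := f _; set c := f _.
have : forall a b c : R, e * a + (1 - e) * b <= c -> (a - b) * e <= c - b.
  by move=> *; lra.
by apply.
Unshelve. all: by end_near. Qed.

(** The gradient is taken at the far end x + z, which is a convex combination of x + z + e z and x
    with weights 1/(1+e) and e/(1+e). Concavity thus bounds the quotient beyond x + z by the
    increment before it. *)
Lemma gradient_le_increment (x z g : vec R T) :
  orthant S x -> orthant S z -> upward_gradient S f (x + z) g ->
  \sum_(a <- S) g a * z a <= f (x + z) - f x.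
Proof.
move=> xS zS /(_ z zS) /cvgr_to_le; apply.
near=> e.
have e0 : 0 < e by near: e; exact: nbhs_right_gt.
rewrite ler_pdivrMr//.
have e1 : 0 < 1 + e by rewrite addr_gt0.
have E : x + z = (1 + e)^-1 *: (x + z + e *: z) + (1 - (1 + e)^-1) *: x.
  apply: vecP => a.
  change (x a + z a = (1 + e)^-1 * (x a + z a + e * z a) +
    (1 - (1 + e)^-1) * x a :> R).
  by field; rewrite gt_eqF.
have /fconc : 0 <= (1 + e)^-1 <= 1.
  by rewrite invr_ge0 (ltW e1) invf_le1// lerDl ltW.
move=> /(_ _ _ (orthantD (orthantD xS zS) (orthantZ (ltW e0) zS)) xS).
rewrite -E.
have : forall a b c : R, (1 + e)^-1 * a + (1 - (1 + e)^-1) * b <= c ->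
    a - c <= (c - b) * e.
  move=> a b c /(ler_wpM2l (ltW e1)).
  rewrite mulrDr !mulrA mulfV ?gt_eqF// mulrBr mulfV ?gt_eqF//.
  by move=> *; lra.
by apply.
Unshelve. all: by end_near. Qed.

End Gradient.

(** * From decreasing gradients to decreasing increments *)

Lemma le_of_harmonic (R : realType) (a b c : R) :
  (forall n, a <= b + c * harmonic n) -> a <= b.
Proof.
move=> abc.
have : b + c * harmonic n @[n --> \oo] --> b.
  rewrite -[X in _ --> X]addr0; apply: cvgD; first exact: cvg_cst.
  by rewrite -(mulr0 c); apply: cvgMr; exact: cvg_harmonic.
by move=> /cvgr_to_ge; apply; near=> n; exact: abc.
Unshelve. all: by end_near. Qed.

(** Cut z into N+1 equal steps w. Each step from v after the first is bounded by the gradient at its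
    start, hence by the gradient at the corresponding point of the path from u, hence by the step
    from u that ends there. The shift by one leaves the first step from v over; it is O(1/(N+1)). *)
Lemma OCDRA_instance_dr (R : realType) (T : choiceType) (A : seq {fset T})
    (f : vec R T -> R) :
  OCDRA_instance A f -> dr_objective (all_options A) f.
Proof.
set S := all_options A => inst.
have fmono := @objective_increasing _ _ _ _ inst.
have fconc : forall (t : R) (x y : vec R T), 0 <= t <= 1 ->
    orthant S x -> orthant S y ->
    t * f x + (1 - t) * f y <= f (t *: x + (1 - t) *: y).
  move=> t x y /andP[t0 t1] xS yS.
  have := @objective_concave _ _ _ _ inst (@Itv01 _ t t0 t1) x y.
  rewrite !inE => /(_ xS yS); rewrite /conv/=.
  have : forall a b c : R, - c <= t * - a + (1 - t) * - b ->
    t * a + (1 - t) * b <= c by move=> *; lra.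
  by apply.
split=> //; first exact: objective0 inst.
move=> u v z uS vS zS uv.
have [g gv] := objective_updiff inst vS.
apply: (@le_of_harmonic _ _ _ (\sum_(a <- S) g a * z a)) => N.
have h0 : 0 <= (N.+1%:R : R)^-1 by rewrite invr_ge0.
pose w : vec R T := N.+1%:R^-1 *: z.
have wS : orthant S w by exact: orthantZ.
have nwS n : orthant S (n%:R *: w) by exact: orthantZ.
have step n : f (v + n.+1%:R *: w) - f v <=
    f (v + w) - f v + (f (u + n%:R *: w) - f u).
  elim: n => [|n IH]; first by rewrite scale1r scale0r addr0 subrr addr0.
  have vnS := orthantD vS (nwS n.+1); have unS := orthantD uS (nwS n).
  have unS' := orthantD uS (nwS n.+1).
  have [gv' hgv] := objective_updiff inst vnS.
  have [gu hgu] := objective_updiff inst unS'.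
  have Su k (x : vec R T) : x + k.+1%:R *: w = x + k%:R *: w + w.
    by rewrite -natr1 scalerDl scale1r addrA.
  have l1 := increment_le_gradient fconc vnS wS hgv.
  have l2 : \sum_(a <- S) gu a * w a <= f (u + n.+1%:R *: w) - f (u + n%:R *: w).
    rewrite Su; apply: (gradient_le_increment fconc unS wS).
    by rewrite -Su.
  have l3 : \sum_(a <- S) gv' a * w a <= \sum_(a <- S) gu a * w a.
    rewrite big_seq [leRHS]big_seq; apply: ler_sum => a aS.
    rewrite ler_wpM2r//; first by case: wS => + _; apply.
    apply: (objective_grad_decreasing inst unS' vnS) => //.
    by move=> b /=; rewrite lerD2r.
  rewrite Su; move: IH l1 l2 l3; rewrite /=.
  set a1 := \sum_(_ <- _) _; set a2 := \sum_(_ <- _) _.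
  have : forall a b c d e h k : R, a - b <= c - b + (d - k) -> e - a <= a1 ->
    a2 <= h - d -> a1 <= a2 -> e - b <= c - b + (h - k) by move=> *; lra.
  by apply.
have Nw : N.+1%:R *: w = z by rewrite scalerA divff ?scale1r// pnatr_eq0.
(* The path from u stops at u + N w, below u + z, and monotonicity fills the gap. The leftover first
   step is at most the gradient at v applied to w. *)
have := step N; rewrite Nw => /le_trans; apply; rewrite addrC lerD//.
  rewrite lerD2r; apply: fmono => //; [exact: orthantD..|].
  move=> a /=; rewrite lerD2l.
  change (N%:R * (N.+1%:R^-1 * z a) <= z a :> R).
  rewrite mulrA ler_piMl//; first by case: zS => + _; apply.
  by rewrite ler_pdivrMr// mul1r ler_nat.
apply: le_trans (increment_le_gradient fconc vS wS gv) _.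
rewrite mulr_suml; apply: ler_sum => a _.
by change (g a * (N.+1%:R^-1 * z a) <= g a * z a * N.+1%:R^-1 :> R);
  rewrite -mulrA (mulrC (z a)).
Qed.

(** * The potential and the inequality that it yields *)

Section Potential.
Context {R : realType} {T : choiceType}.
Implicit Types (S B : {fset T}) (f : vec R T -> R) (x y z : vec R T).

Definition potential (N : nat) f x : R :=
  \sum_(k < N) expR N%:R^-1 ^+ k.+1 * k.+1%:R * f ((N%:R / k.+1%:R) *: x).

Lemma potential_dr N S f : dr_objective S f -> dr_objective S (potential N f).
Proof.
move=> fdr; apply: (@dr_objective_sum _ _ S N (fun k x =>
  expR N%:R^-1 ^+ k.+1 * k.+1%:R * f ((N%:R / k.+1%:R) *: x))) => k.
by apply: dr_objectiveZ => //; rewrite ?mulr_ge0 ?exprn_ge0 ?expR_ge0 ?invr_ge0.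
Qed.

(** This makes the greedy rule online: rescaling stays in the orthant of the revealed options, so
    the revealed objective determines the potential there. *)
Lemma eq_potential N S f f' x : {in orthant S, f =1 f'} -> orthant S x ->
  potential N f x = potential N f' x.
Proof.
move=> ff' xS; apply: eq_bigr => k _; rewrite ff'// inE.
by apply: orthantZ => //; rewrite mulr_ge0 ?invr_ge0.
Qed.

(** With q = e^(1/N) the sum is q (e - 1) / (q - 1), and q - 1 <= q/N because 1/q = e^(-1/N) >= 1 -
    1/N. *)
Lemma geometric_expR_ge N : (0 < N)%N ->
  N%:R * (expR 1 - 1) <= \sum_(k < N) expR N%:R^-1 ^+ k.+1 :> R.
Proof.
move=> N0; have N0' : 0 < N%:R :> R by rewrite ltr0n.
set q := expR N%:R^-1.
have qN : q ^+ N = expR 1 by rewrite -expRM_natr mulVf// gt_eqF.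
have q1 : q - 1 <= q * N%:R^-1.
  have := expR_ge1Dx (- (N%:R : R)^-1); rewrite expRN -/q => h.
  have q0 : 0 < q by exact: expR_gt0.
  have := ler_wpM2l (ltW q0) h; rewrite mulfV ?gt_eqF// mulrDr mulr1 mulrN.
  by move=> ?; lra.
rewrite -qN subrX1 mulrA.
have -> : \sum_(k < N) q ^+ k.+1 = q * \sum_(k < N) q ^+ k.
  by rewrite mulr_sumr; apply: eq_bigr => k _; rewrite exprS.
rewrite ler_wpM2r ?sumr_ge0// => [k _|]; first by rewrite exprn_ge0// expR_ge0.
by rewrite mulrC -ler_pdivlMr.
Qed.

(* The (k+1)-st term at x + y/N dominates f y plus the k-th term at x, because
   N/(k+1) (x + y/N) is a convex combination of N/k x and y; shifting the index
   k costs a factor q = expR (1/N) and the last term at x. *)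
Lemma potential_ge N S f x y : (0 < N)%N -> dr_objective S f ->
  orthant S x -> orthant S y ->
  expR N%:R^-1 * (potential N f x - expR 1 * N%:R * f x)
    + f y * \sum_(k < N) expR N%:R^-1 ^+ k.+1
  <= potential N f (x + N%:R^-1 *: y).
Proof.
move=> N0 fdr xS yS; have N0' : 0 < N%:R :> R by rewrite ltr0n.
set q := expR N%:R^-1; have q0 : 0 <= q by exact: expR_ge0.
have qN : q ^+ N = expR 1 by rewrite -expRM_natr mulVf// gt_eqF.
(* [a k] is q times the k-th term of the potential at x; since [a 0] = 0, the sum over 1..N may be
   read as a sum over 0..N with [a N] split off. *)
pose phi k := k%:R * f ((N%:R / k%:R) *: x).
pose a k := q ^+ k.+1 * phi k.
have shift : q * potential N f x = \sum_(k < N) a k + a N.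
  have -> : \sum_(k < N) a k + a N = \sum_(k < N.+1) a k by rewrite big_ord_recr.
  rewrite big_ord_recl /a /phi mul0r mulr0 add0r mulr_sumr.
  by apply: eq_bigr => k _; rewrite !mulrA -exprS.
have aN : a N = q * (expR 1 * N%:R * f x).
  by rewrite /a /phi mulfV ?gt_eqF// scale1r exprS qN !mulrA.
rewrite mulrBr shift aN addrK mulr_sumr -big_split/=.
apply: ler_sum => k _; rewrite /a (mulrC (f y)) -mulrDr -mulrA ler_wpM2l ?exprn_ge0//.
(* For k = 0 there is no term at x to combine with; monotonicity suffices, as y <= N (x + y/N). *)
rewrite /phi; have [k0|k0] := posnP k.
  rewrite k0 mul0r add0r mul1r divr1; apply: (dr_increasing fdr) => //.
    by apply: orthantZ => //; apply: orthantD => //; apply: orthantZ => //;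
      rewrite invr_ge0.
  move=> b; change (y b <= N%:R * (x b + N%:R^-1 * y b)).
  rewrite mulrDr mulrA mulfV ?gt_eqF// mul1r lerDr mulr_ge0//.
  by case: xS => + _; apply.
have k0' : 0 < k%:R :> R by rewrite ltr0n.
have k1 : 0 < k.+1%:R :> R by rewrite ltr0n.
have t01 : 0 <= (k%:R / k.+1%:R : R) <= 1.
  by rewrite divr_ge0// ler_pdivrMr// mul1r ler_nat leqnSn.
have NkS : orthant S ((N%:R / k%:R) *: x).
  by apply: orthantZ => //; rewrite divr_ge0.
have := dr_concave fdr t01 NkS yS.
have kS : k.+1%:R = k%:R + 1 :> R by rewrite -natr1.
have -> : (k%:R / k.+1%:R) *: ((N%:R / k%:R) *: x) + (1 - k%:R / k.+1%:R) *: y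
    = (N%:R / k.+1%:R) *: (x + N%:R^-1 *: y).
  apply: vecP => b.
  change (k%:R / k.+1%:R * (N%:R / k%:R * x b) + (1 - k%:R / k.+1%:R) * y b
    = N%:R / k.+1%:R * (x b + N%:R^-1 * y b)).
  rewrite kS in k1 *; field.
  by rewrite !gt_eqF.
move=> /(ler_wpM2l (ltW k1)); apply: le_trans.
move: (f _) (f y) => u v; rewrite kS in k1 *; rewrite le_eqVlt.
by apply/orP; left; apply/eqP; field; rewrite gt_eqF.
Qed.

Lemma potential_competitive N S f x y (m : R) :
  (0 < N)%N -> dr_objective S f -> orthant S x -> orthant S y ->
  potential N f (x + N%:R^-1 *: y) <= (1 + N%:R^-1) * potential N f x + m ->
  (1 - (expR 1)^-1) * f y <= expR N%:R^-1 * f x + (expR 1)^-1 * m * N%:R^-1.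
Proof.
move=> N0 fdr xS yS up; have N0' : 0 < N%:R :> R by rewrite ltr0n.
have low := potential_ge N0 fdr xS yS.
have geo := ler_wpM2l (dr_objective_ge0 fdr yS) (geometric_expR_ge N0).
have P0 := dr_objective_ge0 (potential_dr N fdr) xS.
(* The factor 1 + 1/N of the upper bound is absorbed by q, the potential being nonnegative. *)
have := ler_wpM2r P0 (expR_ge1Dx (N%:R^-1 : R)).
have e0 : 0 < expR 1 :> R by exact: expR_gt0.
move: low up geo; set q := expR N%:R^-1; set e := expR 1 in e0 *.
set P := potential _ _ x; set s := \sum_(_ < _) _; set P' := potential _ _ _.
move=> low up geo qP.
have main : f y * (N%:R * (e - 1)) <= q * (e * N%:R * f x) + m.
  have := mulrBr q P (e * N%:R * f x); move: low up geo qP.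
  move: (q * (e * _ * _)) (q * (P - _)) (q * P) (_ * P) (f y * s).
  by move=> *; lra.
rewrite -(ler_pM2r (mulr_gt0 N0' e0)).
have -> : (1 - e^-1) * f y * (N%:R * e) = f y * (N%:R * (e - 1)).
  by field; rewrite gt_eqF.
have -> // : (q * f x + e^-1 * m * N%:R^-1) * (N%:R * e)
    = q * (e * N%:R * f x) + m.
by field; rewrite !gt_eqF.
Qed.

End Potential.

(** * The near-greedy allocation for a fixed N *)

Section Greedy.
Context {R : realType} {T : choiceType}.
Implicit Types (S B : {fset T}) (f : vec R T -> R) (x y z : vec R T).
Implicit Types (A L : seq {fset T}).

Definition simplex B : set (vec R T) :=
  [set z | orthant B z /\ \sum_(a <- B) z a <= 1].

Lemma simplex0 B : simplex B 0.
Proof. by split=> //; rewrite big1. Qed.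

(** With a slack of 1 a finite supremum is enough and no maximizer has to exist. The total slack,
    one unit per item, is later divided by e N. *)
Definition near_optimal N f x B : set (vec R T) :=
  [set z | simplex B z /\ forall z', simplex B z' ->
     potential N f (x + z') <= potential N f (x + z) + 1].

(** The default value 0 lies in the simplex too, so feasibility of the step is separate from
    existence of a near-optimum. *)
Definition greedy_step N f x B : vec R T := xget (0 : vec R T) (near_optimal N f x B).

(* The list L is in reverse order of arrival. *)
Fixpoint greedy N L f : vec R T :=
  if L is B :: L' then
    let x := greedy N L' (reveal (all_options L') f) in x + greedy_step N f x B
  else 0.

Lemma greedy_step_simplex N f x B : simplex B (greedy_step N f x B).
Proof.
rewrite /greedy_step; case: xgetP => [z _ []//|_].
exact: simplex0.
Qed.

Lemma reveal_eq S f : {in orthant S, reveal S f =1 f}.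
Proof. by move=> x xS; rewrite /reveal patchT. Qed.

Lemma reveal_reveal S S' f : (S' `<=` S)%fset ->
  reveal S' (reveal S f) = reveal S' f.
Proof.
move=> S'S; apply: funext => x; rewrite /reveal /patch.
case: ifPn => //; rewrite inE => xS'.
by rewrite ifT// inE; exact: orthant_sub S'S xS'.
Qed.

Lemma all_options_cons B L : all_options (B :: L) = (B `|` all_options L)%fset.
Proof. by rewrite /all_options big_cons. Qed.

Lemma in_all_options A a : (a \in all_options A) = has (fun B => a \in B) A.
Proof.
elim: A => [|B A IH]; first by rewrite /all_options big_nil.
by rewrite all_options_cons in_fsetU IH.
Qed.

Lemma all_options_rev A : all_options (rev A) = all_options A.
Proof. by apply/fsetP => a; rewrite !in_all_options has_rev. Qed.

Lemma all_options_rcons A B :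
  all_options (rcons A B) = (all_options A `|` B)%fset.
Proof.
by apply/fsetP => a; rewrite in_fsetU !in_all_options has_rcons orbC.
Qed.

(** Past allocations are recomputed from present information; restricting the objective again hands
    each recursive call exactly what was known at that earlier arrival. *)
Lemma greedy_cons N B L f :
  greedy N (B :: L) (reveal (all_options (B :: L)) f) =
  greedy N L (reveal (all_options L) f) +
  greedy_step N (reveal (all_options (B :: L)) f)
    (greedy N L (reveal (all_options L) f)) B.
Proof. by rewrite /= reveal_reveal// all_options_cons fsubsetUr. Qed.

Lemma greedy_orthant N L f : orthant (all_options L) (greedy N L f).
Proof.
elim: L f => [|B L IH] f /=; first exact: orthant0.
rewrite all_options_cons; apply: orthantD.
  by apply: orthant_sub (IH _); exact: fsubsetUr.
by case: (greedy_step_simplex N f (greedy N L (reveal (all_options L) f)) B)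
  => /(orthant_sub (fsubsetUl _ _)).
Qed.

(** The potential is bounded over the simplex, so some point comes within 1 of its supremum and
    [xget] does not fall back on its default. Optimality for the revealed objective transfers to f
    because every point compared lies in the revealed orthant. *)
Lemma greedy_step_near_optimal N S S' f x B :
  dr_objective S f -> (S' `<=` S)%fset -> (B `<=` S')%fset -> orthant S' x ->
  forall z, simplex B z -> potential N f (x + z) <=
    potential N f (x + greedy_step N (reveal S' f) x B) + 1.
Proof.
move=> fdr S'S BS' xS'.
have eqP z : orthant S' z -> potential N (reveal S' f) z = potential N f z.
  by apply: eq_potential; exact: reveal_eq.
have xzS' z : simplex B z -> orthant S' (x + z).
  by case=> zB _; apply: orthantD => //; exact: orthant_sub zB.
suff [z0 [z0B z0max]] : near_optimal N (reveal S' f) x B !=set0.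
  move=> z zB; have : near_optimal N (reveal S' f) x B
      (greedy_step N (reveal S' f) x B).
    by rewrite /greedy_step; case: xgetP => // /(_ z0) [].
  case=> gB /(_ _ zB); rewrite !eqP//; exact: xzS'.
have Pdr := potential_dr N fdr.
pose E := [set potential N f (x + z) | z in simplex B].
have Esup : has_sup E.
  split; first by exists (potential N f (x + 0)), 0 => //; exact: simplex0.
  (* The indicator of B dominates the whole simplex, so monotonicity gives an upper bound. *)
  pose u : vec R T := fun a => (a \in B)%:R.
  have uB : orthant B u.
    by split=> [a|a /negbTE aB]; rewrite /u ?ler0n// aB.
  exists (potential N f (x + u)) => _ [z [[z0 zB] z1] <-].
  apply: (dr_increasing Pdr).
  - by apply: orthantD; apply: orthant_sub S'S _ => //; apply: orthant_sub BS' _.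
  - by apply: orthantD; apply: orthant_sub S'S _ => //; apply: orthant_sub BS' _.
  move=> a /=; rewrite lerD2l /u.
  have [aB|/zB -> //] := boolP (a \in B).
  apply: le_trans z1; rewrite (big_fsetD1 a)//= lerDl sumr_ge0//.
have [_ [z zB <-] zsup] := sup_adherent ltr01 Esup.
exists z; split=> // z' z'B; rewrite !eqP; try exact: xzS'.
rewrite -lerBlDr; apply: le_trans (ltW zsup); rewrite lerD2r.
by apply: ub_le_sup; [case: Esup|exists z'].
Qed.

Definition restrict S x : vec R T := fun a => if a \in S then x a else 0.

Lemma restrict_orthant S S' x : orthant S x -> orthant S' (restrict S' x).
Proof.
move=> [x0 _]; split=> a; rewrite /restrict; first by case: ifP.
by move=> /negbTE ->.
Qed.

Lemma restrict_id S x : orthant S x -> restrict S x = x.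
Proof.
move=> [_ xS]; apply: vecP => a; rewrite /restrict.
by case: ifPn => // /xS.
Qed.

Lemma restrictU S B x : [disjoint B & S]%fset ->
  restrict (B `|` S)%fset x = restrict S x + restrict B x.
Proof.
move=> /fdisjointP BS; apply: vecP => a.
change (restrict (B `|` S)%fset x a = restrict S x a + restrict B x a).
rewrite /restrict in_fsetU; have [/BS/negbTE ->|_] := boolP (a \in B).
  by rewrite add0r.
by rewrite addr0.
Qed.

Lemma sum_restrict B x : \sum_(a <- B) restrict B x a = \sum_(a <- B) x a.
Proof. by rewrite big_seq [RHS]big_seq; apply: eq_bigr => a aB; rewrite /restrict aB. Qed.

Lemma fdisjoint_all_options B L :
  all (fun C : {fset T} => [disjoint B & C]%fset) L ->
  [disjoint B & all_options L]%fset.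
Proof.
move=> /allP BL; apply/fdisjointP => a aB; rewrite in_all_options.
apply/hasPn => C /BL /fdisjointP; exact.
Qed.

(** By disjointness only the step of B itself is nonzero on B, and that step lies in the simplex. *)
Lemma greedy_feasible N L f :
  pairwise (fun B C => [disjoint B & C]%fset) L ->
  forall B, B \in L ->
    \sum_(a <- B) greedy N L (reveal (all_options L) f) a <= 1.
Proof.
elim: L => // C L IH; rewrite pairwise_cons => /andP[CL dL] B.
have /fdisjointP CS := fdisjoint_all_options CL.
rewrite greedy_cons; set x := greedy _ _ _; set w := greedy_step _ _ _ _.
have [wC w1] : simplex C w := greedy_step_simplex _ _ _ _.
have xL : orthant (all_options L) x := greedy_orthant _ _ _.
rewrite in_cons => /orP[/eqP -> {B}|BL].
  apply: le_trans w1; rewrite big_seq [leRHS]big_seq; apply: ler_sum => a /CS aC.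
  by change (x a + w a <= w a); case: xL => _ ->//; rewrite add0r.
apply: le_trans (IH dL B BL); rewrite big_seq [leRHS]big_seq.
apply: ler_sum => a aB; change (x a + w a <= x a).
case: wC => _ ->; rewrite ?addr0//.
by move: CL => /allP/(_ _ BL); rewrite fdisjoint_sym => /fdisjointP; apply.
Qed.

(* Perturbing towards a competitor gains at most 1/N of the potential: by
   near-optimality and concavity this holds one item at a time, and diminishing
   returns add up these gains. *)
Lemma greedy_potential N S L f y : (0 < N)%N -> dr_objective S f ->
  orthant S y -> pairwise (fun B C => [disjoint B & C]%fset) L ->
  (all_options L `<=` S)%fset ->
  (forall B, B \in L -> \sum_(a <- B) y a <= 1) ->
  let x := greedy N L (reveal (all_options L) f) in
  potential N f (x + N%:R^-1 *: restrict (all_options L) y)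
    <= (1 + N%:R^-1) * potential N f x + (size L)%:R.
Proof.
move=> N0 fdr yS; have Pdr := potential_dr N fdr.
have N0' : 0 < N%:R :> R by rewrite ltr0n.
set e : R := N%:R^-1; have e0 : 0 <= e by rewrite invr_ge0.
have e1 : e <= 1 by rewrite invf_le1// ler1n.
elim: L => [_ _ _ /=|B L IH].
  have -> : restrict (all_options [::]) y = 0.
    by apply: vecP => a; rewrite /restrict /all_options big_nil.
  by rewrite scaler0 addr0 (dr0 Pdr) mulr0 add0r.
rewrite pairwise_cons => /andP[BL dL] LS yL.
rewrite greedy_cons; move: LS; rewrite all_options_cons => LS.
have LS' : (all_options L `<=` S)%fset := fsubset_trans (fsubsetUr _ _) LS.
have BS : (B `<=` S)%fset := fsubset_trans (fsubsetUl _ _) LS.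
have /= := IH dL LS' (fun C CL => yL C (mem_behead (s := B :: L) CL)).
set x := greedy _ _ _.
have xL : orthant (all_options L) x := greedy_orthant _ _ _.
have xS : orthant S x := orthant_sub LS' xL.
have := greedy_step_near_optimal N fdr LS (fsubsetUl _ _)
  (orthant_sub (fsubsetUr _ _) xL).
have := greedy_step_simplex N (reveal (B `|` all_options L)%fset f) x B.
set w := greedy_step _ _ _ _ => -[wB w1] wmax {}IH.
rewrite (restrictU _ (fdisjoint_all_options BL)).
set yB := restrict B y; set z := restrict (all_options L) y in IH *.
have yBB : orthant B yB := restrict_orthant _ yS.
have yBS := orthant_sub BS yBB.
have zS : orthant S z := orthant_sub LS' (restrict_orthant _ yS).
have wS := orthant_sub BS wB.
have e1' : 0 <= 1 - e by rewrite subr_ge0.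
have e01 : 0 <= 1 - e <= 1 by rewrite e1' lerBlDr lerDl.
(* Shrinking the step w makes room for e yB: v + e yB is again in the simplex, so w competes with
   it. *)
pose v : vec R T := (1 - e) *: w.
have vS : orthant S v by exact: orthantZ.
have eyS : orthant S (e *: yB) by exact: orthantZ.
have ezS : orthant S (e *: z) by exact: orthantZ.
have near_max : potential N f (x + v + e *: yB) <= potential N f (x + w) + 1.
  rewrite -addrA; apply: wmax; split.
    by apply: orthantD; exact: orthantZ.
  rewrite (eq_bigr (fun a => (1 - e) * w a + e * yB a))//.
  rewrite big_split/= -!mulr_sumr sum_restrict.
  have := ler_wpM2l e1' w1; have := ler_wpM2l e0 (yL B (mem_head _ _)).
  by move: (\sum_(_ <- _) _) (\sum_(_ <- _) _) => *; lra.
(* Concavity bounds the loss from w to v by e (P (x + w) - P x), where P is the potential. *)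
have conc := dr_concave Pdr e01 (orthantD xS wS) xS.
have xvE : (1 - e) *: (x + w) + (1 - (1 - e)) *: x = x + v.
  by rewrite scalerDr addrAC -scalerDl addrC subrKC scale1r addrC.
rewrite xvE in conc.
have dB : potential N f (x + w + e *: yB) - potential N f (x + w) <=
    potential N f (x + v + e *: yB) - potential N f (x + v).
  apply: (dr_increment Pdr) => //; [exact: orthantD..|].
  move=> a; change (x a + (1 - e) * w a <= x a + w a).
  by rewrite lerD2l ler_piMl//; [case: wB => + _; apply|case/andP: e01].
(* The move along the earlier items gains no more here than at x, where the induction hypothesis
   bounds the gain by e P x + [size L]. The term e P x cancels against the one from concavity. *)
have dL' : potential N f (x + w + e *: yB + e *: z)
    - potential N f (x + w + e *: yB) <=
    potential N f (x + e *: z) - potential N f x.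
  apply: (dr_increment Pdr) => //.
    by apply: orthantD => //; exact: orthantD.
  rewrite -addrA; apply: lev_addr => a.
  change (0 <= w a + e * yB a); rewrite addr_ge0//; first by case: wB.
  by rewrite mulr_ge0//; case: yBB.
rewrite scalerDr (addrC (e *: z)) addrA -natr1.
move: near_max conc dB dL' IH.
move: (potential N f (x + w + e *: yB + e *: z)) => p1.
move: (potential N f (x + w + e *: yB)) (potential N f (x + v + e *: yB)).
move: (potential N f (x + w)) (potential N f (x + v)).
move: (potential N f (x + e *: z)) (potential N f x) (size L)%:R.
by move=> *; lra.
Qed.

End Greedy.

(** * The greedy rule as an online algorithm *)

Section Online.
Context {R : realType} {T : choiceType}.
Implicit Types (S B : {fset T}) (f : vec R T -> R) (x y z : vec R T).
Implicit Types A : seq {fset T}.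

Definition greedy_algorithm (N : nat) : online_algorithm R T :=
  fun A f => greedy N (rev A) f.

(** Reading each option off the decision of its own item gives the final greedy vector, since later
    steps vanish on earlier options. *)
Lemma allocation_greedy N A f :
  pairwise (fun B C => [disjoint B & C]%fset) A ->
  allocation (greedy_algorithm N) A f
    = greedy N (rev A) (reveal (all_options A) f).
Proof.
elim/last_ind: A => [_|A B IH].
  by apply: vecP => a; rewrite /allocation in_all_options.
rewrite -cats1 pairwise_cat allrel1r andbC /= => /andP[dA BA].
have {}IH := IH (andP dA).1.
have AB : [disjoint B & all_options A]%fset.
  by apply: fdisjoint_all_options; apply: sub_all BA => C; rewrite fdisjoint_sym.
rewrite cats1; apply: vecP => a; rewrite /allocation.
case: ifPn => [|/= aAB]; last first.
  have [_ ->] // := greedy_orthant N (rev (rcons A B))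
    (reveal (all_options (rcons A B)) f).
  by rewrite all_options_rev.
rewrite all_options_rcons in_fsetU => aAB.
have [aA|aA] := boolP (a \in all_options A); last first.
  rewrite (negbTE aA) /= in aAB.
  have -> : find (fun C : {fset T} => a \in C) (rcons A B) = size A.
    rewrite -cats1 find_cat; move: aA; rewrite in_all_options => /negbTE ->.
    by rewrite /= aAB addn0.
  by rewrite /decision -(size_rcons A B) take_size all_options_rcons.
have := IH; move/(congr1 (fun x : vec R T => x a)); rewrite /allocation aA.
have hA : has (fun C : {fset T} => a \in C) A by rewrite -in_all_options.
have lA : (find (fun C : {fset T} => a \in C) A < size A)%N by rewrite -has_find.
rewrite -cats1 find_cat hA /decision takel_cat// => ->.
rewrite -(all_options_rcons A B) -[in RHS]all_options_rev.
rewrite cats1 rev_rcons greedy_cons all_options_rev.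
set x := greedy _ _ _; set w := greedy_step _ _ _ _.
have [[_ wB] _] : simplex B w := greedy_step_simplex _ _ _ _.
change (x a = x a + w a); rewrite wB ?addr0//.
by apply: contraL aA => aB; have /fdisjointP := AB; apply.
Qed.

Lemma pairwise_disjoint_rev A :
  pairwise (fun B C => [disjoint B & C]%fset) A ->
  pairwise (fun B C => [disjoint B & C]%fset) (rev A).
Proof.
elim: A => // B A IH; rewrite pairwise_cons rev_cons pairwise_rcons.
move=> /andP[BA /IH ->]; rewrite andbT all_rev; apply: sub_all BA => C.
by rewrite fdisjoint_sym.
Qed.

Lemma greedy_algorithm_feasible N A f :
  pairwise (fun B C => [disjoint B & C]%fset) A ->
  feasible A (allocation (greedy_algorithm N) A f).
Proof.
move=> dA; rewrite allocation_greedy// -all_options_rev; split.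
  by rewrite -(all_options_rev A); exact: greedy_orthant.
move=> B BA; apply: greedy_feasible; last by rewrite mem_rev.
exact: pairwise_disjoint_rev.
Qed.

Lemma greedy_algorithm_competitive N A f y : (0 < N)%N ->
  OCDRA_instance A f -> feasible A y ->
  (1 - (expR 1)^-1) * f y <=
    expR N%:R^-1 * f (allocation (greedy_algorithm N) A f)
    + (expR 1)^-1 * (size A)%:R * N%:R^-1.
Proof.
move=> N0 inst [yS yA]; have fdr := OCDRA_instance_dr inst.
have dA := options_disjoint inst.
have [xS _] := greedy_algorithm_feasible N f dA.
apply: (potential_competitive N0 fdr xS yS).
rewrite allocation_greedy// -all_options_rev -[in X in X <= _](restrict_id yS).
rewrite -(all_options_rev A) -(size_rev A).
apply: (greedy_potential N0 fdr yS); first exact: pairwise_disjoint_rev.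
  by rewrite all_options_rev.
by move=> B; rewrite mem_rev; exact: yA.
Qed.

Lemma feasible_le1 A x a : feasible A x -> 0 <= x a <= 1.
Proof.
move=> [[x0 xS] x1]; rewrite x0/=.
have [|/xS ->//] := boolP (a \in all_options A).
rewrite in_all_options => /hasP[B BA aB]; apply: le_trans (x1 _ BA).
by rewrite (big_fsetD1 a)//= lerDl sumr_ge0.
Qed.

(** As x <= y + |x - y|, monotonicity and diminishing returns bound f x - f y by the increment of |x
    - y| at 0, which the gradient at 0 controls. This carries coordinatewise convergence over to
    f. *)
Lemma dr_objective_lipschitz S f (g : vec R T) x y : dr_objective S f ->
  upward_gradient S f 0 g -> orthant S x -> orthant S y ->
  f x <= f y + \sum_(a <- S) g a * `|x a - y a|.
Proof.
move=> fdr g0 xS yS; pose d : vec R T := fun a => `|x a - y a|.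
have dS : orthant S d.
  split=> a; rewrite /d// => aS; case: xS => _ ->//; case: yS => _ ->//.
  by rewrite subrr normr0.
have O : orthant S (0 : vec R T) := orthant0 S.
have := increment_le_gradient (dr_concave fdr) O dS g0.
have y0 : lev 0 y by move=> a; case: yS => + _; exact.
have := dr_increment fdr O yS dS y0.
have : f x <= f (y + d).
  apply: (dr_increasing fdr) => //; first exact: orthantD.
  by move=> a; change (x a <= y a + `|x a - y a|); rewrite -lerBlDl ler_norm.
rewrite -[\sum_(_ <- _) g _ * `|_|]/(\sum_(a <- S) g a * d a).
by move: (\sum_(_ <- _) _) (f (y + d)) (f (0 + d)) (f x) (f y) (f 0) => *; lra.
Qed.

End Online.

(** * The limit of the greedy algorithms along an ultrafilter *)

Lemma bounded_ultra_cvg (R : realType) (I : Type) (U : set_system I)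
    (u : I -> R) (a b : R) :
  UltraFilter U -> (forall i, a <= u i <= b) -> cvg (u i @[i --> U]).
Proof.
move=> UU uab; have UF : ProperFilter U := @ultra_proper _ _ UU.
have Uab : (u i @[i --> U]) `[a, b]%classic.
  by rewrite /fmap/=; apply: filterE => i /=; rewrite in_itv/= uab.
have [p [_ pcl]] := @segment_compact R a b _ _ Uab.
apply/cvg_ex; exists p => V pV.
(* Otherwise the complement of V would belong to the image filter and have to meet V, as p is a
   cluster point. *)
have [//|UV] := in_ultra_setVsetC (u @^-1` V) UU.
by have [z []] := pcl (~` V) V UV pV.
Qed.

Section Limit.
Context {R : realType} {T : choiceType} (U : set_system nat).
Hypothesis UU : UltraFilter U.
Hypothesis oo_U : \oo `<=` U.

Let UF : ProperFilter U := @ultra_proper _ _ UU.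

(* A limit along an ultrafilter, so that the limits of successive decisions are
   consistent with each other, unlike limits along subsequences. *)
Definition limit_algorithm : online_algorithm R T :=
  fun A f a => lim (greedy_algorithm N.+1 A f a @[N --> U]).

(** The allocation at [a] reads one coordinate of one decision, and the limit is taken in exactly
    that coordinate; feasibility confines it to [0, 1], so the limit exists. *)
Lemma limit_algorithm_cvg (A : seq {fset T}) (f : vec R T -> R) a :
  pairwise (fun B C => [disjoint B & C]%fset) A ->
  allocation (greedy_algorithm N.+1) A f a @[N --> U] -->
    allocation limit_algorithm A f a.
Proof.
move=> dA; have : cvg (allocation (greedy_algorithm N.+1) A f a @[N --> U]).
  apply: (@bounded_ultra_cvg _ _ _ _ 0 1) => N.
  by apply: feasible_le1; exact: greedy_algorithm_feasible.
rewrite /allocation; case: ifPn => // _ _; exact: cvg_cst.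
Qed.

Lemma limit_algorithm_feasible (A : seq {fset T}) (f : vec R T -> R) :
  pairwise (fun B C => [disjoint B & C]%fset) A ->
  feasible A (allocation limit_algorithm A f).
Proof.
move=> dA; have fs N := greedy_algorithm_feasible (R := R) N f dA.
split; first split.
- move=> a; apply: (cvgr_to_ge (limit_algorithm_cvg (a := a) dA)).
  by apply: filterE => N; have [[+ _] _] := fs N.+1; exact.
- by move=> a /negbTE aS; rewrite /allocation aS.
- move=> B BA; have : \sum_(a <- B) allocation (greedy_algorithm N.+1) A f a
      @[N --> U] --> \sum_(a <- B) allocation limit_algorithm A f a.
    apply: cvg_big => [|a _]; first exact: add_continuous.
    exact: limit_algorithm_cvg.
  move=> /cvgr_to_le; apply.
  by apply: filterE => N; have [_] := fs N.+1; exact.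
Qed.

Lemma limit_algorithm_competitive :
  competitive (1 - (expR 1)^-1) limit_algorithm.
Proof.
move=> A f inst; have dA := options_disjoint inst.
have xf := limit_algorithm_feasible f dA; split=> // y yf.
have [xS _] := xf; move: xS; set x := allocation limit_algorithm A f => xS.
pose xN N := allocation (greedy_algorithm (R := R) N.+1) A f.
have fdr := OCDRA_instance_dr inst.
have [g g0] := objective_updiff inst (orthant0 (all_options A)).
pose err N := \sum_(a <- all_options A) g a * `|xN N a - x a|.
(* [harmonic N] is 1/(N+1), matching [greedy_algorithm N.+1], whose index is always positive. *)
pose bound N := expR (harmonic N) * (f x + err N)
  + (expR 1)^-1 * (size A)%:R * harmonic N.
(* U refines the filter at infinity, so ordinary limits are limits along U. *)
have h0 : harmonic N @[N --> U] --> (0 : R).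
  exact: cvg_trans (cvg_app _ oo_U) cvg_harmonic.
have err0 : err N @[N --> U] --> (0 : R).
  rewrite (_ : 0 = \sum_(a <- all_options A) g a * 0); last first.
    by rewrite big1// => a _; rewrite mulr0.
  apply: cvg_big => [|a _]; first exact: add_continuous.
  apply: cvgMr; rewrite -(normr0 R) -(subrr (x a)); apply: cvg_norm.
  by apply: cvgB; [exact: limit_algorithm_cvg|exact: cvg_cst].
have : bound N @[N --> U] --> expR 0 * (f x + 0)
    + (expR 1)^-1 * (size A)%:R * (0 : R).
  apply: cvgD; last by apply: cvgMr.
  apply: cvgM; last by apply: cvgD => //; exact: cvg_cst.
  by apply: continuous_cvg h0; exact: continuous_expR.
rewrite expR0 mulr0 !addr0 mul1r => /cvgr_to_ge; apply.
apply: filterE => N; have [xNS _] := greedy_algorithm_feasible (R := R) N.+1 f dA.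
apply: le_trans (greedy_algorithm_competitive (ltn0Sn N) inst yf) _.
rewrite lerD2r ler_wpM2l ?expR_ge0//.
exact: (dr_objective_lipschitz fdr g0).
Qed.

End Limit.

Theorem theorem1p2 (R : realType) (T : choiceType) :
  exists alg : online_algorithm R T, competitive (1 - (expR 1)^-1) alg.
Proof.
have [U [UU oo_U]] := @ultraFilterLemma nat \oo _.
by exists (limit_algorithm U); exact: limit_algorithm_competitive.
Qed.
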